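(* Let $X$ be a completely regular topological space and $Y\subseteq X$ be a compact, metrizable subset. For each locally convex space $F$, the restriction map $$C(X,F)\to C(Y,F)$$ then admits a continuous linear right inverse $\mathcal{E}\colon C(Y,F)\to C(X,F)$ such that $\mathcal{E}(\gamma)(X)$ is contained in the convex hull of $\gamma(Y)$ for each $\gamma\in C(Y,F)$.
   Context: ''Locally convex space'' means a real, Hausdorff locally convex topological vector space (not assumed complete). Completely regular spaces are assumed Hausdorff. $C(X,F)$ is the space of all continuous maps $X\to F$, endowed with the compact-open topology.
   Formalization: The requirement that E(γ)(X) lie in the convex hull of γ(Y) is stated only for nonempty Y, since for empty Y and nonempty X the hull is empty and the requirement fails; the continuous linear right inverse is still claimed for empty Y. *)

(* Defs.v *)
From HB Require Import structures.
From mathcomp Require Import all_boot all_order all_algebra.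
From mathcomp Require Import all_classical all_reals all_analysis.
Import Order.TTheory GRing.Theory Num.Theory.
Import numFieldNormedType.Exports.
Import ArrowAsCompactOpen.

Set Implicit Arguments.
Unset Strict Implicit.
Unset Printing Implicit Defensive.

Local Open Scope classical_set_scope.
Local Open Scope ring_scope.

Definition metrizable (R : realType) (T : topologicalType) : Prop :=
  exists d : T -> T -> R,
    [/\ forall x, d x x = 0,
        forall x y, d x y = 0 -> x = y,
        forall x y, d x y = d y x,
        forall x y z, d x z <= d x y + d y z
      & forall x (A : set T),
          nbhs x A <-> exists2 e : R, 0 < e & [set y | d x y < e] `<=` A].

Definition convex_hull (R : numDomainType) (M : lmodType R) (A : set M) :
  set M := smallest (@convex_set R M) A.

Section cts_zmodType.
Context {X : topologicalType} {F : topologicalZmodType}.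
Implicit Types f g : continuousType X F.

Let cts_zero : continuousType X F := cst 0.

Let cts_opp_subproof f : continuous (fun x => - f x).
Proof.
by move=> x; apply: continuous_comp; [exact: cts_fun|exact: opp_continuous].
Qed.

Let cts_add_subproof f g : continuous (fun x => f x + g x).
Proof.
move=> x; apply: (@continuous_comp _ _ _ (fun x => (f x, g x))
  (fun z : F * F => z.1 + z.2)); last exact: add_continuous.
by apply: cvg_pair; exact: cts_fun.
Qed.

Let cts_opp f : continuousType X F := mkcts (@cts_opp_subproof f).

Let cts_add f g : continuousType X F := mkcts (@cts_add_subproof f g).

Let cts_addA : associative cts_add.
Proof. by move=> f g h; apply/continuousEP => x; exact: addrA. Qed.

Let cts_addC : commutative cts_add.
Proof. by move=> f g; apply/continuousEP => x; exact: addrC. Qed.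

Let cts_add0 : left_id cts_zero cts_add.
Proof. by move=> f; apply/continuousEP => x; exact: add0r. Qed.

Let cts_addN : left_inverse cts_zero cts_opp cts_add.
Proof. by move=> f; apply/continuousEP => x; exact: addNr. Qed.

HB.instance Definition _ := GRing.isZmodule.Build (continuousType X F)
  cts_addA cts_addC cts_add0 cts_addN.

Lemma cts_addE f g x : (f + g) x = f x + g x. Proof. by []. Qed.

End cts_zmodType.

Section cts_lmodType.
Context {X : topologicalType} {R : numDomainType} {F : topologicalLmodType R}.
Implicit Types f g : continuousType X F.

Let cts_scale_subproof (a : R) f : continuous (fun x => a *: f x).
Proof.
move=> x; apply: (@continuous_comp _ (R^o * F)%type _ (fun x => (a, f x))
  (fun z : R^o * F => z.1 *: z.2)); last exact: scale_continuous.
by apply: (@cvg_pair _ _ _ _ (nbhs (a : R^o))); [exact: cvg_cst|exact: cts_fun].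
Qed.

Let cts_scale (a : R) f : continuousType X F := mkcts (@cts_scale_subproof a f).

Let cts_scaleA a b f : cts_scale a (cts_scale b f) = cts_scale (a * b) f.
Proof. by apply/continuousEP => x; exact: scalerA. Qed.

Let cts_scale1 : left_id 1 cts_scale.
Proof. by move=> f; apply/continuousEP => x; exact: scale1r. Qed.

Let cts_scaleDr : right_distributive cts_scale +%R.
Proof. by move=> a f g; apply/continuousEP => x; exact: scalerDr. Qed.

Let cts_scaleDl f : {morph cts_scale^~ f : a b / a + b}.
Proof. by move=> a b; apply/continuousEP => x; exact: scalerDl. Qed.

HB.instance Definition _ := GRing.Zmodule_isLmodule.Build R (continuousType X F)
  cts_scaleA cts_scale1 cts_scaleDr cts_scaleDl.

Lemma cts_scaleE a f x : (a *: f) x = a *: f x. Proof. by []. Qed.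

End cts_lmodType.

Section cts_restrict.
Context {X F : topologicalType} (Y : set X).

Let cts_restrict_subproof (f : continuousType X F) :
  continuous (fun y : Y => f (set_val y)).
Proof.
move=> y; apply: continuous_comp; last exact: cts_fun.
exact: initial_continuous.
Qed.

Definition cts_restrict (f : continuousType X F) : continuousType Y F :=
  mkcts (@cts_restrict_subproof f).

End cts_restrict.

(* Main.v *)
(** A Dugundji extension along a continuous pseudometric. Complete regularity
    and compactness of [Y] yield countably many continuous functions on [X]
    from which one builds a continuous pseudometric [rho] on [X] inducing the
    topology of [Y]. Let [D] be the [rho]-distance to [Y] and [y_n] a
    [rho]-dense sequence in [Y]. Where [D > 0], the value [E g x] is a locally
    finite convex combination of those [g y_n] with [rho x y_n < 2 * D x];
    where [D x = 0], it is [g y] for the unique [y] in [Y] with [rho x y = 0].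
    All sums being finite, [F] need not be complete and the values lie in the
    convex hull itself, not only in its closure. *)

From HB Require Import structures.
From mathcomp Require Import finmap.
Require Import Defs.
From mathcomp Require Import all_boot all_order all_algebra.
From mathcomp Require Import all_classical all_reals all_analysis.
From mathcomp Require Import ring lra.
Import Order.TTheory GRing.Theory Num.Theory.
Import numFieldNormedType.Exports.
(* Endows [continuousType X F] with the compact-open topology. *)
Import ArrowAsCompactOpen.

Set Implicit Arguments.
Unset Strict Implicit.
Unset Printing Implicit Defensive.

Local Open Scope classical_set_scope.
Local Open Scope ring_scope.

(** * Finite choice over compact sets *)

Lemma compact_finite_choice (T : topologicalType) (K : set T) (A : Type)
    (P : A -> T -> Prop) : compact K ->
  (forall p, K p -> exists a, \forall q \near p, P a q) ->
  exists n (a : 'I_n -> A), forall p, K p -> exists i, P (a i) p.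
Proof.
move=> cK locP.
have [K0|/set0P [p0 Kp0]] := eqVneq K set0.
  have a (i : 'I_0) : A by case: i.
  by exists 0, a => p; rewrite K0.
(* [a0] only serves as a default value of [c] outside [K]; for empty [K], where [A] may be empty
   too, the family is empty. *)
have [a0 _] := locP _ Kp0.
have /choice [c cP] p : exists a, K p -> \forall q \near p, P a q.
  have [/locP [a aP]|nKp] := pselect (K p); first by exists a.
  by exists a0 => /nKp.
(* The filter of large finite subsets of [T]: near-covering compactness along it says that some
   finite set of centres serves all of [K]. *)
pose F := filter_from setT
  (fun s : {fset T} => [set t : {fset T} | (s `<=` t)%fset]).
have FF : ProperFilter F.
  apply: filter_from_proper; last by move=> s _; exists s => /=.
  apply: filter_from_filter; first by exists fset0.
  move=> s t _ _; exists (s `|` t)%fset => // u /=.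
  by rewrite fsubUset => /andP.
have FK : F [set s : {fset T} |
    K `<=` [set p | exists2 q, q \in s & P (c q) p]].
  move/compact_near_coveringP : cK => cK.
  apply: (cK _ F (fun s p => exists2 q, q \in s & P (c q) p)) => p Kp.
  exists ([set q | P (c p) q],
    [set s : {fset T} | ([fset p] `<=` s)%fset]) => /=.
    by split; [exact: cP|exists [fset p]%fset].
  by move=> [q s] /= [qP ps]; exists p => //; rewrite -fsub1set.
have [s sP] := @filter_ex _ F FF _ FK.
exists (size s), (fun i => c (tnth (in_tuple s) i)) => p /sP [q qs qP].
have iq : (index q s < size s)%N by rewrite index_mem.
by exists (Ordinal iq); rewrite (tnth_nth p0) /= nth_index.
Qed.

(** * Continuous pseudometrics *)

Section pseudometric.
Context {R : realType} {X : topologicalType}.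

(** Continuity is asked at the diagonal only; the triangle inequality spreads it to every
    [rho x]. *)
Definition cont_pseudometric (rho : X -> X -> R) :=
  [/\ forall x, rho x x = 0, forall x y, rho x y = rho y x,
      forall x y z, rho x z <= rho x y + rho y z
    & forall x e, 0 < e -> \forall y \near x, rho x y < e].

Lemma cont_pseudometric_ge0 rho x y : cont_pseudometric rho -> 0 <= rho x y.
Proof.
move=> [rho0 rhoC rhoD _]; have := rhoD x y x.
rewrite rho0 (rhoC y x); lra.
Qed.

Lemma cont_pseudometric_continuous rho x :
  cont_pseudometric rho -> continuous (rho x : X -> R^o).
Proof.
move=> [rho0 rhoC rhoD rhoc] y; apply/cvgrPdist_lt => e e0.
apply: filterS (rhoc y _ e0) => z yz; rewrite ltr_norml.
have := rhoD x y z; have := rhoD x z y; rewrite (rhoC z y); lra.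
Qed.

Lemma cont_pseudometric_dist (f : X -> R) : continuous (f : X -> R^o) ->
  cont_pseudometric (fun x y => `|f x - f y|).
Proof.
move=> fc; split.
- by move=> x; rewrite subrr normr0.
- by move=> x y; rewrite distrC.
- by move=> x y z; exact: ler_distD.
- by move=> x e e0; move/cvgrPdist_lt: (fc x); apply.
Qed.

Lemma cont_pseudometric_sum n (rho : 'I_n -> X -> X -> R) :
  (forall i, cont_pseudometric (rho i)) ->
  cont_pseudometric (fun x y => \sum_i rho i x y).
Proof.
move=> rhoP; split.
- by move=> x; rewrite big1 // => i _; have [->] := rhoP i.
- by move=> x y; apply: eq_bigr => i _; have [_ ->] := rhoP i.
- move=> x y z; rewrite -big_split /=; apply: ler_sum => i _.
  by have [_ _ ->] := rhoP i.
- move=> x e e0.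
  have : (fun y => \sum_i rho i x y) @ x --> (\sum_i rho i x x : R^o).
    apply: (@cvg_big _ _ _ _ _ (@add_continuous R^o)) => i _.
    exact: cont_pseudometric_continuous.
  rewrite [X in _ --> X]big1 => [/cvgrPdist_lt/(_ _ e0)|i _]; last first.
    by have [->] := rhoP i.
  apply: filterS => y; rewrite sub0r normrN ger0_norm //.
  by apply: sumr_ge0 => i _; exact: cont_pseudometric_ge0.
Qed.

Lemma cont_pseudometric_min1 rho : cont_pseudometric rho ->
  cont_pseudometric (fun x y => Num.min 1 (rho x y)).
Proof.
move=> rhoP; have [rho0 rhoC rhoD rhoc] := rhoP; split.
- by move=> x; rewrite rho0; apply/min_idPr.
- by move=> x y; rewrite rhoC.
- move=> x y z; have := rhoD x y z.
  have := @cont_pseudometric_ge0 _ x y rhoP.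
  have := @cont_pseudometric_ge0 _ y z rhoP.
  by rewrite !minEle; do !case: ifPn; rewrite -?ltNge; lra.
- move=> x e /(rhoc x); apply: filterS => y.
  by rewrite gt_min => ->; rewrite orbT.
Qed.

(** Take the supremum of [rho k x y / k.+1]. The triangle inequality passes to suprema, and the
    bound by 1 makes the terms with large [k] uniformly small, so that continuity involves finitely
    many [k] only. *)
Lemma cont_pseudometric_sup (rho : nat -> X -> X -> R) :
  (forall k, cont_pseudometric (rho k)) ->
  (forall k x y, rho k x y <= 1) ->
  exists2 sigma, cont_pseudometric sigma
    & forall k x y, rho k x y <= k.+1%:R * sigma x y.
Proof.
move=> rhoP rho1.
pose S x y := range (fun k => rho k x y / k.+1%:R).
have Sub x y : has_sup (S x y).
  split; first by exists (rho 0%N x y / 1); exists 0%N.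
  exists 1 => _ [k _ <-]; rewrite ler_pdivrMr ?ltr0n // mul1r.
  by rewrite (le_trans (rho1 _ _ _)) // ler1n.
have leS x y k : rho k x y / k.+1%:R <= sup (S x y).
  by apply: ub_le_sup; [have [] := Sub x y|exists k].
have Sle x y c : (forall k, rho k x y / k.+1%:R <= c) -> sup (S x y) <= c.
  move=> cP; apply: ge_sup; first by have [] := Sub x y.
  by move=> _ [k _ <-].
exists (fun x y => sup (S x y)); last first.
  by move=> k x y; rewrite mulrC -ler_pdivrMr ?ltr0n.
split.
- move=> x; apply/eqP; rewrite eq_le Sle => [|k]; last first.
    by have [-> _ _ _] := rhoP k; rewrite mul0r.
  by apply: le_trans (leS x x 0%N); have [-> _ _ _] := rhoP 0%N; rewrite mul0r.
- move=> x y; congr (sup (_ @` _)); apply/funext => k.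
  by have [_ -> _ _] := rhoP k.
- move=> x y z; apply: Sle => k.
  apply: le_trans (lerD (leS x y k) (leS y z k)).
  rewrite -mulrDl ler_pM2r ?invr_gt0 ?ltr0n //.
  by have [_ _ ->] := rhoP k.
- move=> x e e0.
  have e20 : 0 < e / 2 by rewrite divr_gt0.
  (* Terms with index at least [N] are at most [e / 2] everywhere; only those below [N] constrain
     [y]. *)
  pose N := (Num.truncn (e / 2)^-1).+1.
  have : \forall y \near x, forall i : 'I_N, rho i x y < e / 2.
    apply: filter_forall => i.
    by have [_ _ _] := rhoP i; exact.
  apply: filterS => y yN; apply: (@le_lt_trans _ _ (e / 2)); last by lra.
  apply: Sle => k; rewrite ler_pdivrMr ?ltr0n //.
  have [kN|Nk] := ltnP k N.
    apply: le_trans (ltW (yN (Ordinal kN))) _ => /=.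
    by rewrite ler_peMr ?ler1n // ltW.
  apply: le_trans (rho1 _ _ _) _; rewrite -ler_pdivrMl // mulr1.
  apply: (@le_trans _ _ N%:R); last by rewrite ler_nat leqW.
  by rewrite ltW // /N truncnS_gt.
Qed.

End pseudometric.

(** * A continuous pseudometric inducing the topology of the compact subset *)

Lemma compact_set_type (X : topologicalType) (Y : set X) :
  compact Y -> compact [set: Y].
Proof.
move=> /compact_near_coveringP cY; apply/compact_near_coveringP.
move=> J F P FF covP.
(* Compactness of [Y] speaks of points [x] of [X], hence the quantification over elements of the
   subtype lying above [x]. *)
have FQ : F [set i | Y `<=` [set x | forall y : Y, set_val y = x -> P i y]].
  apply: (cY J F (fun i x => forall y : Y, set_val y = x -> P i y)) => x Yx.
  have [[V S] /= [Vy FS] VSP] := covP (exist _ x (mem_set Yx)) I.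
  have [_ [[W oW <-] Wx] WV] := Vy.
  exists (W, S) => /=; first by split=> //; exact: open_nbhs_nbhs.
  move=> [x' i] /= [Wx1 Si] y yx'; apply: (VSP (y, i)); split => //=.
  by apply: WV; rewrite /= yx'.
apply: filterS FQ => i Qi y _; apply: (Qi (set_val y)) => //.
exact: set_valP.
Qed.

(** For each [k], compactness of [Y * Y] yields finitely many continuous functions on [X] such that
    any pair at [d]-distance at least [1 / k.+1] is told apart by one of them. Their oscillations
    sum to a pseudometric [rho k], truncated at 1, and the [rho k] are merged by a weighted
    supremum. *)
Lemma separating_pseudometric (R : realType) (X : topologicalType) (Y : set X) :
  hausdorff_space X -> completely_regular_space X -> compact Y ->
  metrizable R Y ->
  exists2 rho : X -> X -> R, cont_pseudometric rho
    & forall (y : Y) (U : set Y), nbhs y U ->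
      exists2 e : R, 0 < e
        & forall z : Y, rho (set_val y) (set_val z) < e -> U z.
Proof.
move=> X_T2 X_cr Y_compact [d [d0 d_eq0 dC dD d_nbhs]].
have YY_compact : compact [set: Y * Y].
  rewrite -setXTT.
  exact: compact_setX (compact_set_type _) (compact_set_type _).
have d_cont a e : 0 < e -> \forall b \near a, d a b < e.
  by move=> e0; apply/d_nbhs; exists e.
have valc : continuous (set_val : Y -> X) by exact: initial_continuous.
have near1 (p : Y * Y) (A : set Y) : nbhs p.1 A -> \forall q \near p, A q.1.
  by move=> Ap; exists (A, setT) => [|q []//]; split=> //; exact: filterT.
have near2 (p : Y * Y) (A : set Y) : nbhs p.2 A -> \forall q \near p, A q.2.
  by move=> Ap; exists (setT, A) => [|q []//]; split=> //; exact: filterT.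
have /choice [rho rhoP] k : exists rho : X -> X -> R,
    [/\ cont_pseudometric rho, forall x y, rho x y <= 1
      & forall y z : Y, rho (set_val y) (set_val z) < 1 / 2 ->
          d y z < k.+1%:R^-1].
  pose e : R := k.+1%:R^-1.
  have e0 : 0 < e by rewrite invr_gt0 ltr0n.
  pose P (f : continuousType X R^o) (p : Y * Y) :=
    d p.1 p.2 < e \/ 1 / 2 <= `|f (set_val p.1) - f (set_val p.2)|.
  have [p _|n [f fP]] := compact_finite_choice (P := P) YY_compact.
    have [dp|dp] := ltP (d p.1 p.2) e.
      pose r := (e - d p.1 p.2) / 2.
      have r0 : 0 < r by rewrite divr_gt0 ?subr_gt0.
      (* Close to the diagonal any function will do. Moving each coordinate by less than half the
         slack [e - d p.1 p.2] keeps the pair within [e]. *)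
      exists (cst 0); near=> q; left.
      have q1 : d p.1 q.1 < r.
        near: q; exact: (near1 p [set z | d p.1 z < r] (d_cont _ _ r0)).
      have q2 : d p.2 q.2 < r.
        near: q; exact: (near2 p [set z | d p.2 z < r] (d_cont _ _ r0)).
      have := dD q.1 p.1 q.2; have := dD p.1 p.2 q.2; rewrite (dC q.1 p.1).
      by move: q1 q2; rewrite /r; lra.
    have [f [fc f01 f0 f1]] : exists f : X -> R, [/\ continuous f,
        range f `<=` `[0, 1], f @` [set set_val p.1] `<=` [set 0]
        & f @` [set set_val p.2] `<=` [set 1]].
      apply/uniform_separatorP; apply: X_cr.
        exact/accessible_closed_set1/hausdorff_accessible.
      move=> /= p12; move: dp; suff -> : p.2 = p.1 by rewrite d0 leNgt e0.
      exact/esym/val_inj.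
    (* The values of [f] at the two points are 0 and 1; an error below 1/4 at each leaves a gap of
       at least 1/2. *)
    exists (mkcts fc); near=> q; right.
    have fp1 : f (set_val p.1) = 0 by apply: f0; exists (set_val p.1).
    have fp2 : f (set_val p.2) = 1 by apply: f1; exists (set_val p.2).
    have q1 : `|f (set_val p.1) - f (set_val q.1)| < 1 / 4.
      near: q.
      apply: (near1 p [set z | `|f (set_val p.1) - f (set_val z)| < 1 / 4]).
      have /cvgrPdist_lt : f \o set_val @ p.1 --> f (set_val p.1).
        by apply: continuous_comp; [exact: valc|exact: fc].
      by apply; lra.
    have q2 : `|f (set_val p.2) - f (set_val q.2)| < 1 / 4.
      near: q.
      apply: (near2 p [set z | `|f (set_val p.2) - f (set_val z)| < 1 / 4]).
      have /cvgrPdist_lt : f \o set_val @ p.2 --> f (set_val p.2).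
        by apply: continuous_comp; [exact: valc|exact: fc].
      by apply; lra.
    move: q1 q2; rewrite fp1 fp2 /=.
    move=> /ltr_normlP [q1 q1'] /ltr_normlP [q2 q2'].
    by rewrite distrC ler_normr; apply/orP; left; rewrite /mkcts; lra.
  pose sigma x y := \sum_i `|f i x - f i y|.
  have sigmaP : cont_pseudometric sigma.
    apply: (cont_pseudometric_sum (rho := fun i x y => `|f i x - f i y|)) => i.
    by apply: cont_pseudometric_dist => x; exact: cts_fun.
  exists (fun x y => Num.min 1 (sigma x y)); split.
  - exact: cont_pseudometric_min1.
  - by move=> x y; rewrite ge_min lexx.
  - move=> y z; rewrite gt_min => /orP[|yz]; first by lra.
    have [i [//|]] := fP (y, z) I; rewrite leNgt => /negP[].
    apply: le_lt_trans yz; rewrite /sigma (bigD1 i) //= lerDl.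
    by apply: sumr_ge0.
have rhoP1 k : cont_pseudometric (rho k) by have [] := rhoP k.
have [|sigma sigmaP rho_sigma] := cont_pseudometric_sup rhoP1.
  by move=> k x y; have [_ ->] := rhoP k.
exists sigma => // y U /d_nbhs [e e0 eU].
pose k := Num.truncn e^-1.
have ke : k.+1%:R^-1 <= e.
  by rewrite -[e]invrK lef_pV2 ?posrE ?invr_gt0 ?ltr0n // ltW ?truncnS_gt.
(* Since [rho k] is at most [k.+1] times [sigma], this radius forces [rho k] below 1/2. *)
exists (1 / 2 / k.+1%:R) => [|z yz]; first by rewrite !divr_gt0 ?ltr0n.
apply: eU; apply: lt_le_trans ke; have [_ _] := rhoP k; apply.
apply: le_lt_trans (rho_sigma _ _ _) _.
by rewrite mulrC -ltr_pdivlMr ?ltr0n.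
Unshelve. all: by end_near. Qed.

Lemma metrizable_hausdorff (R : realType) (T : topologicalType) :
  metrizable R T -> hausdorff_space T.
Proof.
move=> [d [d0 d_eq0 dC dD d_nbhs]] p q pq; apply: d_eq0.
have d_ge0 : 0 <= d p q by have := dD p q p; rewrite d0 (dC q p); lra.
apply/eqP; rewrite eq_le d_ge0 andbT leNgt; apply/negP => d_gt0.
have e0 : 0 < d p q / 2 by rewrite divr_gt0.
have ball_nbhs x : nbhs x [set y | d x y < d p q / 2].
  by apply/d_nbhs; exists (d p q / 2).
have [z [/= pz qz]] := pq _ _ (ball_nbhs p) (ball_nbhs q).
by have := dD p z q; rewrite (dC z q); lra.
Qed.

(** * Finite convex combinations *)

Section average.
Context {R : realType} {T : choiceType}.
Implicit Types s : seq (R * T).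

Definition prob_weights s :=
  all (fun p => 0 <= p.1) s && (\sum_(p <- s) p.1 == 1).

Definition average {F : lmodType R} s (g : T -> F) :=
  \sum_(p <- s) p.1 *: g p.2.

Lemma average_is_linear {F : lmodType R} s (a : R) (g h : T -> F) :
  average s (fun x => a *: g x + h x) = a *: average s g + average s h.
Proof.
rewrite /average scaler_sumr -big_split /=; apply: eq_bigr => p _.
by rewrite scalerDr !scalerA mulrC.
Qed.

(** Induction on the list. Entries of weight zero are exempt because the kernel built below may list
    points far from [x] with weight zero. *)
Lemma convex_average {F : lmodType R} (A : set F) s (g : T -> F) :
  convex_set (A : set (convex_lmodType F)) -> prob_weights s ->
  (forall p, p \in s -> p.1 != 0 -> A (g p.2)) -> A (average s g).
Proof.
move=> cA /andP[s_ge0 /eqP s1] sA.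
(* Dividing by the total weight gives a statement that is inherited by the tail of the list, whose
   weights need not sum to 1. *)
suff : 0 < \sum_(p <- s) p.1 ->
    A ((\sum_(p <- s) p.1)^-1 *: \sum_(p <- s) p.1 *: g p.2).
  by rewrite s1 invr1 scale1r; apply.
elim: s s_ge0 sA {s1} => [|p s IHs] /=; first by rewrite big_nil ltxx.
move=> /andP[p_ge0 s_ge0] sA; rewrite !big_cons.
set S := \sum_(_ <- _) _; set V := \sum_(_ <- _) _ => pS_gt0.
have [p0|p_neq0] := eqVneq p.1 0.
  rewrite p0 scale0r !add0r in pS_gt0 *.
  by apply: IHs => // q sq; apply: sA; rewrite inE sq orbT.
have pA : A (g p.2) by apply: sA => //; rewrite inE eqxx.
have p_gt0 : 0 < p.1 by rewrite lt_neqAle eq_sym p_neq0.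
have S_ge0 : 0 <= S.
  by rewrite /S big_seq; apply: sumr_ge0 => q; exact: (allP s_ge0).
have [S0|S_neq0] := eqVneq S 0.
  have -> : V = 0.
    rewrite /V big_seq big1 // => q sq.
    have /eqP := S0; rewrite /S big_seq psumr_eq0; last exact: (allP s_ge0).
    by move/allP => /(_ q sq); rewrite sq /= => /eqP ->; rewrite scale0r.
  by rewrite S0 !addr0 scalerA mulVf // scale1r.
have S_gt0 : 0 < S by rewrite lt_neqAle eq_sym S_neq0.
have VA : A (S^-1 *: V).
  by apply: IHs => // q sq; apply: sA; rewrite inE sq orbT.
have l0 : 0 <= p.1 / (p.1 + S) by rewrite divr_ge0 // ltW.
have l1 : p.1 / (p.1 + S) <= 1 by rewrite ler_pdivrMr // mul1r lerDl.
have := cA _ _ (Itv01 l0 l1) (mem_set pA) (mem_set VA).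
move/set_mem; congr (A _); rewrite /conv /= scalerDr !scalerA.
congr (_ *: _ + _ *: _); first exact: mulrC.
by rewrite /unstable.onem; field; rewrite S_neq0 gt_eqF // ltr_wpDr.
Qed.

End average.

(* Mather's trick: [w_n = max(0, u_n - n * (u_0 + ... + u_(n-1)))] vanishes for
   large [n] near any point where some [u_m] is positive, and agrees with [u_n]
   for the least [n] such that [u_n] is positive. *)
Lemma locally_finite_weights (R : realType) (X : topologicalType)
    (u : nat -> X -> R) :
  (forall n, continuous (u n : X -> R^o)) ->
  (forall n x, 0 <= u n x <= 1) ->
  exists2 w : nat -> X -> R,
    [/\ forall n, continuous (w n : X -> R^o), forall n x, 0 <= w n x
      & forall n x, u n x = 0 -> w n x = 0]
    & forall x, (exists n, 0 < u n x) ->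
      (exists n, 0 < w n x) /\
      exists N, \forall z \near x, forall n, (N <= n)%N -> w n z = 0.
Proof.
move=> u_cont u01.
have u_ge0 n x : 0 <= u n x by have /andP[] := u01 n x.
have u_le1 n x : u n x <= 1 by have /andP[] := u01 n x.
pose s n x := n%:R * \sum_(0 <= i < n) u i x.
have s_ge0 n x : 0 <= s n x by rewrite mulr_ge0 // sumr_ge0.
exists (fun n x => Num.max 0 (u n x - s n x)); first split.
- move=> n x; apply: (@continuous_max R X (cst 0) (fun z => u n z - s n z) x).
    exact: cvg_cst.
  apply: cvgB; first exact: u_cont.
  apply: cvgM; first exact: cvg_cst.
  by apply: (@cvg_big _ _ _ _ _ (@add_continuous R^o)) => i _; exact: u_cont.
- by move=> n x; rewrite le_max lexx.
- by move=> n x ->; apply/max_idPl; rewrite sub0r oppr_le0.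
move=> x ux; split.
  case: (ex_minnP ux) => n un_gt0 n_min; exists n.
  rewrite lt_max /s big_nat big1 ?mulr0 ?subr0 ?un_gt0 ?orbT //.
  move=> i /andP[_ ni].
  apply/eqP; rewrite eq_le u_ge0 andbT leNgt; apply/negP => /n_min.
  by rewrite leqNgt ni.
have [m um_gt0] := ux; pose c := u m x / 2.
have c_gt0 : 0 < c by rewrite divr_gt0.
(* The first bound puts [u m] among the summands of [s n]; the second gives [n * c >= 1], which
   dominates [u n]. *)
exists (maxn m.+1 (Num.truncn c^-1).+1).
have : \forall z \near x, `|u m x - u m z| < c.
  by move/cvgrPdist_lt : (u_cont m x); apply.
apply: filterS => z /ltr_normlP [_ uz] n; rewrite geq_max => /andP[mn cn].
apply/max_idPl; rewrite subr_le0 (le_trans (u_le1 n z)) //.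
have cu : c <= u m z by move: uz; rewrite /c; lra.
have cV_le : c^-1 <= n%:R.
  apply: le_trans (_ : (Num.truncn c^-1).+1%:R <= _); last by rewrite ler_nat.
  by rewrite ltW ?truncnS_gt.
apply: le_trans (_ : n%:R * c <= _); first by rewrite -ler_pdivrMr // mul1r.
rewrite ler_wpM2l // (le_trans cu) //.
rewrite (big_cat_nat (n := m)) //=; last exact: ltnW.
by rewrite (big_ltn mn) addrCA lerDl addr_ge0 ?sumr_ge0.
Qed.

(** * The Dugundji averaging kernel *)

Section averaging_kernel.
Context {R : realType} {X T : topologicalType} (v : T -> X) (rho : X -> X -> R)
  (t0 : T).
Context (T_compact : compact [set: T]) (T_hausdorff : hausdorff_space T).
Context (v_cont : continuous v) (rhoP : cont_pseudometric rho).
Context (rho_nbhs : forall t (U : set T), nbhs t U ->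
  exists2 e : R, 0 < e & forall s, rho (v t) (v s) < e -> U s).

Lemma pseudometric_dense_sequence : exists y : nat -> T,
  forall t e, 0 < e -> exists n, rho (v t) (v (y n)) < e.
Proof.
have [rho0 rhoC rhoD rhoc] := rhoP.
have /choice [a aP] k : exists a : {n & 'I_n -> T},
    forall t, exists i, rho (v (tagged a i)) (v t) < k.+1%:R^-1.
  have [|n [a aP]] := compact_finite_choice
      (P := fun s t => rho (v s) (v t) < k.+1%:R^-1) T_compact.
    move=> t _; exists t.
    by apply: (v_cont (rhoc (v t) _ _)); rewrite invr_gt0 ltr0n.
  by exists (existT _ n a) => t; exact: aP.
(* The finite [1 / k.+1]-nets are strung into one sequence by decoding [m] as a pair of a level and
   an index; [t0] fills the codes that decode to nothing. *)
exists (fun m => if (unpickle m : option {k & 'I_(tag (a k))}) is Some i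
  then tagged (a (tag i)) (tagged i) else t0).
move=> t e e0; pose k := Num.truncn e^-1.
have [i ti] := aP k t.
exists (pickle (Tagged (fun k => 'I_(tag (a k))) i)); rewrite pickleK /= rhoC.
apply: lt_le_trans ti _.
by rewrite -[e]invrK lef_pV2 ?posrE ?invr_gt0 ?ltr0n // ltW ?truncnS_gt.
Qed.

Let pdist x := inf (range (fun t => rho x (v t))).

Let has_inf_pdist x : has_inf (range (fun t => rho x (v t))).
Proof.
split; first by exists (rho x (v t0)); exists t0.
by exists 0 => _ [t _ <-]; exact: cont_pseudometric_ge0.
Qed.

Let pdist_le x t : pdist x <= rho x (v t).
Proof. by apply: ge_inf; [have [] := has_inf_pdist x|exists t]. Qed.

Let pdist_ge0 x : 0 <= pdist x.
Proof.
apply: lb_le_inf; first by have [] := has_inf_pdist x.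
by move=> _ [t _ <-]; exact: cont_pseudometric_ge0.
Qed.

Let pdist_attained x : exists t, rho x (v t) = pdist x.
Proof.
have [||t _ tmin] :=
  @compact_EVT_min T R (fun t => rho x (v t)) [set: T] _ T_compact.
- by exists t0.
- apply: continuous_subspaceT => s.
  apply: (@continuous_comp _ _ _ v (rho x)); first exact: v_cont.
  exact: cont_pseudometric_continuous.
exists t; apply/eqP; rewrite eq_le pdist_le andbT.
apply: lb_le_inf; first by have [] := has_inf_pdist x.
by move=> _ [s _ <-]; apply: tmin; exact: mem_set.
Qed.

Let pdist_lip x z : pdist x <= rho x z + pdist z.
Proof.
have [_ _ rhoD _] := rhoP; have [t <-] := pdist_attained z.
exact: le_trans (pdist_le x t) (rhoD _ _ _).
Qed.

Let pdist_cont : continuous (pdist : X -> R^o).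
Proof.
have [_ rhoC _ rhoc] := rhoP.
move=> x; apply/cvgrPdist_lt => e e0.
apply: filterS (rhoc x _ e0) => z xz; rewrite ltr_norml.
have := pdist_lip x z; have := pdist_lip z x; rewrite (rhoC z x); lra.
Qed.

(** [rho] may vanish between distinct points of [X], but not on [T]: at distance 0, [s] lies in
    every neighbourhood of [t]. *)
Let rho_eq0 t s : rho (v t) (v s) = 0 -> t = s.
Proof.
move=> ts0; apply: T_hausdorff => A B At Bs; exists s; split.
  by have [e e0] := rho_nbhs At; apply; rewrite ts0.
exact: nbhs_singleton.
Qed.

(* [mu x] is a finitely supported probability measure on [T], written as a list
   of pairs (weight, point); [mu (v t)] is the Dirac mass at [t]. *)
Definition averaging_kernel (mu : X -> seq (R * T)) :=
  [/\ forall x, prob_weights (mu x), forall t, mu (v t) = [:: (1, t)]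
    & forall (F : tvsType R) (g : T -> F), continuous g ->
        continuous (fun x => average (mu x) g)].

Lemma averaging_kernel_exists : exists mu, averaging_kernel mu.
Proof.
have [rho0 rhoC rhoD rhoc] := rhoP.
have [y y_dense] := pseudometric_dense_sequence.
have near_y x : 0 < pdist x -> exists n, rho x (v (y n)) < 2 * pdist x.
  move=> x_gt0; have [t xt] := pdist_attained x.
  have [n tn] := y_dense t _ x_gt0; exists n.
  by have := rhoD x (v t) (v (y n)); rewrite xt; lra.
(* [u n] is positive exactly where [y n] is a nearly closest point, within twice the distance; the
   clamping keeps its values in the unit interval. *)
pose u n x := Num.min 1 (Num.max 0 (2 * pdist x - rho x (v (y n)))).
have u_gt0 n x : (0 < u n x) = (rho x (v (y n)) < 2 * pdist x).
  by rewrite /u lt_min ltr01 lt_max ltxx subr_gt0.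
have [||w [w_cont w_ge0 wu] w_fin] := @locally_finite_weights R X u.
- move=> n x; apply: (@continuous_min R X (cst 1)
    (fun x => Num.max 0 (2 * pdist x - rho x (v (y n)))) x).
    exact: cvg_cst.
  apply: (@continuous_max R X (cst 0)
    (fun x => 2 * pdist x - rho x (v (y n))) x); first exact: cvg_cst.
  apply: cvgB; first by apply: cvgM; [exact: cvg_cst|exact: pdist_cont].
  under eq_fun => z do rewrite rhoC.
  rewrite (rhoC x).
  exact: cont_pseudometric_continuous.
- by move=> n x; rewrite /u le_min ler01 le_max lexx ge_min lexx.
have w_near n x : w n x != 0 -> rho x (v (y n)) <= 2 * pdist x.
  by apply: contra_neqT; rewrite -ltNge => lt; apply: wu; apply/eqP;
    rewrite eq_le leNgt u_gt0 -leNgt ltW //= /u le_min ler01 le_max lexx.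
(* One cut-off index per point, valid on a whole neighbourhood; it is arbitrary where [pdist]
   vanishes. *)
have /choice [N NP] x : exists N, 0 < pdist x ->
    \forall z \near x, forall n, (N <= n)%N -> w n z = 0.
  have [x_gt0|x_le0] := ltP 0 (pdist x); last by exists 0%N.
  have [|_ [N NP]] := w_fin x; last by exists N.
  by have [n nP] := near_y x x_gt0; exists n; rewrite u_gt0.
have /choice [r rP] x : exists t, rho x (v t) = pdist x.
  exact: pdist_attained.
have pdist_v t : pdist (v t) = 0.
  by apply/eqP; rewrite eq_le pdist_ge0 andbT -[leRHS](rho0 (v t)) pdist_le.
have r_v t : r (v t) = t by apply/esym/rho_eq0; rewrite rP pdist_v.
pose W x := \sum_(0 <= i < N x) w i x.
have W_gt0 x : 0 < pdist x -> 0 < W x.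
  move=> x_gt0; have [|[n wn_gt0] _] := w_fin x.
    by have [n nP] := near_y x x_gt0; exists n; rewrite u_gt0.
  have nN : (n < N x)%N.
    rewrite ltnNge; apply: contraTN wn_gt0 => Nn.
    by rewrite (nbhs_singleton (NP x x_gt0)) // ltxx.
  rewrite /W (bigD1_seq n) ?mem_index_iota ?iota_uniq //=.
  by rewrite ltr_pwDl // sumr_ge0.
pose mu x := if pdist x == 0 then [:: (1, r x)]
  else [seq (w i x / W x, y i) | i <- index_iota 0 (N x)].
have mu_prob x : prob_weights (mu x).
  rewrite /prob_weights /mu; case: eqVneq => [_|x_neq0].
    by rewrite /= ler01 big_seq1 /=.
  have x_gt0 : 0 < pdist x by rewrite lt_neqAle eq_sym x_neq0 pdist_ge0.
  have W_neq0 : W x != 0 by rewrite gt_eqF // W_gt0.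
  rewrite all_map big_map -mulr_suml divff // eqxx andbT.
  by apply/allP => i _ /=; rewrite divr_ge0 // ltW ?W_gt0.
have mu_near x p : p \in mu x -> p.1 != 0 -> rho x (v p.2) <= 2 * pdist x.
  rewrite /mu; case: eqVneq => [x0|_].
    by rewrite inE => /eqP -> _; rewrite /= rP x0 mulr0.
  move=> /mapP [i _ ->] /=; rewrite mulf_eq0 negb_or => /andP[wi _].
  exact: w_near.
exists mu; split=> //.
  by move=> t; rewrite /mu pdist_v eqxx r_v.
move=> F g g_cont x.
have [x0|x_neq0] := eqVneq (pdist x) 0.
  have mux : average (mu x) g = g (r x).
    by rewrite /mu x0 eqxx /average big_seq1 scale1r.
  move=> V /=; rewrite mux => V_nbhs.
  have [B B_convex [B_open B_basis]] := @locally_convex R F.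
  have [V' [BV' V'r] V'V] := B_basis _ _ V_nbhs.
  have V'_nbhs : nbhs (g (r x)) V'.
    by apply: open_nbhs_nbhs; split => //; exact: B_open.
  have [e e_gt0 eV'] := rho_nbhs (g_cont _ _ V'_nbhs).
  (* If [rho x z < e / 4], then [pdist z < e / 4], so points of nonzero weight in [mu z] lie within
     [e / 4 + 2 * (e / 4) < e] of [r x]; convexity of [V'] then keeps the average in [V']. *)
  have e4 : 0 < e / 4 by rewrite divr_gt0.
  apply: filterS (rhoc x _ e4) => z xz; apply: V'V.
  apply: convex_average (mu_prob z) _ => [|p pz p_neq0].
    exact: B_convex (mem_set BV').
  apply: eV'; have := mu_near z p pz p_neq0.
  have := rhoD (v (r x)) x (v p.2); have := rhoD x z (v p.2).
  have := pdist_lip z x; rewrite (rhoC (v (r x)) x) (rhoC z x) rP x0.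
  by move: xz; lra.
have x_gt0 : 0 < pdist x by rewrite lt_neqAle eq_sym x_neq0 pdist_ge0.
(* The cut-off [N z] jumps with [z]; this replaces it near [x] by the fixed [n = N x], turning the
   average into a fixed finite sum of continuous terms. *)
have sum_N z n (E : lmodType R) (h : nat -> E) :
    (forall i, (n <= i)%N -> w i z = 0) ->
    (forall i, (N z <= i)%N -> w i z = 0) ->
    \sum_(0 <= i < N z) w i z *: h i = \sum_(0 <= i < n) w i z *: h i.
  suff widen m m' : (m <= m')%N -> (forall i, (m <= i)%N -> w i z = 0) ->
      \sum_(0 <= i < m) w i z *: h i = \sum_(0 <= i < m') w i z *: h i.
    move=> wn wN; have [le|/ltnW le] := leqP (N z) n; first exact: widen.
    exact/esym/widen.
  move=> mm' wm; rewrite (big_cat_nat (n := m) (p := m')) //=.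
  rewrite [X in _ = _ + X]big_nat [X in _ = _ + X]big1 ?addr0 //.
  by move=> i /andP[mi _]; rewrite wm // scale0r.
pose n := N x.
pose f z := (\sum_(0 <= i < n) w i z)^-1 *: \sum_(0 <= i < n) w i z *: g (y i).
have fE : \forall z \near x, average (mu z) g = f z.
  have pdist_gt0 : \forall z \near x, 0 < pdist z.
    by apply: (cvgr_gt _ (pdist_cont (x := x))).
  near=> z; have z_gt0 : 0 < pdist z by near: z.
  have wz : forall i, (n <= i)%N -> w i z = 0 by near: z; exact: NP.
  have wN := nbhs_singleton (NP z z_gt0).
  rewrite /average /mu gt_eqF // big_map /f /=.
  have wW : W z = \sum_(0 <= i < n) w i z.
    rewrite /W (eq_bigr (fun i => w i z *: (1 : R^o))) => [|i _].
      by rewrite (sum_N z n) //; apply: eq_bigr => i _; exact: mulr1.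
    exact/esym/mulr1.
  rewrite -wW -(sum_N z n F (g \o y) wz wN) scaler_sumr.
  by apply: eq_bigr => i _; rewrite scalerA mulrC.
rewrite /continuous_at (nbhs_singleton fE).
apply: cvg_trans (near_eq_cvg _) _.
  by apply: filterS fE => z ->.
apply: (@continuous_comp _ (R^o * F)%type _
  (fun z => ((\sum_(0 <= i < n) w i z)^-1, \sum_(0 <= i < n) w i z *: g (y i)))
  (fun z : R^o * F => z.1 *: z.2)); last exact: scale_continuous.
apply: (@cvg_pair _ _ _ _ (nbhs (_ : R^o))).
  apply: cvgV; first by rewrite gt_eqF // W_gt0.
  by apply: (@cvg_big _ _ _ _ _ (@add_continuous R^o)) => i _; exact: w_cont.
apply: (@cvg_big _ _ _ _ _ (@add_continuous F)) => i _.
apply: (@continuous_comp _ (R^o * F)%type _ (fun z => (w i z, g (y i)))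
  (fun z : R^o * F => z.1 *: z.2)); last exact: scale_continuous.
by apply: (@cvg_pair _ _ _ _ (nbhs (_ : R^o))); [exact: w_cont|exact: cvg_cst].
Unshelve. all: by end_near. Qed.

End averaging_kernel.

(* The uniform structure of [F] need not be the translation-invariant one, so
   uniform closeness is expressed through neighbourhoods of [0]. *)
Lemma cts_sub_near (R : realType) (T : topologicalType) (F : tvsType R)
    (g : continuousType T F) (V : set F) :
  compact [set: T] -> hausdorff_space T -> nbhs 0 V ->
  nbhs g [set h : continuousType T F | forall t, V (h t - g t)].
Proof.
move=> T_compact T_hausdorff V0.
(* Local compactness and regularity make evaluation jointly continuous; compactness then makes the
   estimate uniform in [t]. *)
have T_lcompact : locally_compact [set: T].
  move=> t _; rewrite withinET; exists setT; first exact: filterT.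
  by split=> //; exact: closedT.
have T_regular : regular_space T.
  by move=> t; apply: (compact_regular T_hausdorff T_compact); exact: filterT.
have eval_cont := eval_continuous (Y := F) T_lcompact T_regular.
have near_compact := proj1 (compact_near_coveringP _) T_compact _ (nbhs g)
  (fun (h : continuousType T F) t => V (h t - g t)) (nbhs_filter g).
apply: filterS (near_compact _) => [h hV t|t _]; first exact: hV.
have sub_cont : (fun p : F * F => p.1 - p.2) @ (g t, g t) --> g t - g t.
  exact: (@sub_continuous F (g t, g t)).
rewrite subrr in sub_cont.
have [[A B] /= [gA gB] ABV] := sub_cont _ V0.
have [[G U] /= [Gg Ut] GUA] := eval_cont (g, t) A gA.
exists (U `&` g @^-1` B, G) => /= [|[s h] /= [[Us Bgs] Gh]].
  by split=> //; apply: filterI => //; exact: (@cts_fun _ _ g t B gB).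
apply: (ABV (h s, g s)); split => //=.
exact: (GUA (h, s)).
Qed.

(** Continuity of addition at each [(k, 0)] gives a local margin, and compactness of [K] a common
    one. *)
Lemma nbhs_add_compact (R : numDomainType) (F : topologicalLmodType R)
    (K W : set F) : compact K -> open W -> K `<=` W ->
  \forall v \near (0 : F), forall k, K k -> W (k + v).
Proof.
move=> /compact_near_coveringP K_compact W_open KW.
apply: (K_compact F (nbhs 0) (fun v k => W (k + v))) => k Kk.
have add_cont : (fun p : F * F => p.1 + p.2) @ (k, 0) --> k + 0.
  exact: (@add_continuous F (k, 0)).
rewrite addr0 in add_cont.
exact: add_cont (open_nbhs_nbhs (conj W_open (KW k Kk))).
Qed.

(* The convex hull of the empty set is empty, so the hull condition can only
   be asked for when Y is nonempty (otherwise it fails for X nonempty). *)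
Theorem corollary8p6 (R : realType) (X : topologicalType) (Y : set X)
    (X_T2 : hausdorff_space X) (X_cr : completely_regular_space X)
    (Y_compact : compact Y) (Y_metrizable : metrizable R Y)
    (F : tvsType R) (F_T2 : hausdorff_space F) :
  exists E : {linear continuousType Y F -> continuousType X F},
    [/\ continuous (E : continuousType Y F -> continuousType X F),
        cancel E (cts_restrict Y)
      & Y !=set0 -> forall g : continuousType Y F,
          range (E g) `<=` convex_hull (range g)].
Proof.
have [Y0|/set0P [y0 Yy0]] := eqVneq Y set0.
  have E0_linear : linear (cst 0 : continuousType Y F -> continuousType X F).
    by move=> a g h; rewrite scaler0 addr0.
  pose E : {linear continuousType Y F -> continuousType X F} :=
    HB.pack (cst 0 : continuousType Y F -> continuousType X F)
      (GRing.isLinear.Build _ _ _ _ _ E0_linear).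
  exists E; split.
  - move=> g.
    exact: (@cvg_cst (continuousType X F) 0 (continuousType Y F) (nbhs g)).
  - move=> g; apply/continuousEP => y.
    (* Over the empty set all maps agree, so the zero operator is a right inverse. *)
    by have : set0 (set_val y) by rewrite -Y0; exact: set_valP.
  - by move=> /set0P/eqP.
have YT_compact := compact_set_type Y_compact.
have YT_hausdorff := metrizable_hausdorff Y_metrizable.
have val_cont : continuous (set_val : Y -> X) by exact: initial_continuous.
have [rho rhoP rho_nbhs] :=
  separating_pseudometric X_T2 X_cr Y_compact Y_metrizable.
have [mu [mu_prob mu_val mu_cont]] := averaging_kernel_exists
  (exist _ y0 (mem_set Yy0) : Y) YT_compact YT_hausdorff val_cont rhoP rho_nbhs.
pose E (g : continuousType Y F) : continuousType X F :=
  mkcts (mu_cont F g (@cts_fun _ _ g)).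
have E_linear : linear E.
  by move=> a g h; apply/continuousEP => x; exact: average_is_linear.
pose E' : {linear continuousType Y F -> continuousType X F} :=
  HB.pack E (GRing.isLinear.Build _ _ _ _ _ E_linear).
exists E'; split.
- move=> g; apply: (@continuous_comp_initial _ _ _
    (id : continuousType X F -> (X -> F)) E) => {}g.
  (* It suffices to test maps sending a compact [K] into an open [W]. By linearity [E h] is [E g]
     plus an average of values of [h - g], which stays in the convex neighbourhood [V] of 0. *)
  apply: (proj2 (@compact_open_cvgP X F _ (E g)
    (fmap_filter _ (nbhs_filter g)))) => K W K_compact W_open EgKW.
  have EgK_compact : compact (E g @` K).
    apply: continuous_compact K_compact; apply: continuous_subspaceT.
    exact: cts_fun.
  have W0 := nbhs_add_compact EgK_compact W_open EgKW.
  have [B B_convex [B_open B_basis]] := @locally_convex R F.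
  have [V [BV V0] VW] := B_basis _ _ W0.
  have V_nbhs : nbhs 0 V by apply: open_nbhs_nbhs; split => //; exact: B_open.
  apply: filterS (cts_sub_near g YT_compact YT_hausdorff V_nbhs) => h hV.
  move=> _ [x Kx <-] /=.
  have -> : E h x = E g x + E (h - g) x.
    have -> : E (h - g) = E h - E g := linearB E' h g.
    have -> : (E h - E g) x = E h x - E g x by [].
    by rewrite addrC subrK.
  apply: (VW) (E g x) _; last by exists x.
  apply: convex_average (mu_prob x) _ => [|p _ _]; last exact: hV.
  exact: B_convex (mem_set BV).
- move=> g; apply/continuousEP => y.
  by rewrite /= /mkcts /= mu_val /average big_seq1 scale1r.
- move=> _ g _ [x _ <-] A [A_convex gA].
  by apply: convex_average (mu_prob x) _ => // p _ _; apply: gA; exists p.2.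
Qed.
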